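(* Let $K$ be a (constant, real) $n\times n$ antisymmetric matrix, let $H\colon\mathbb R^n\times\mathbb R^n\to\mathbb R$, $(z,z_x)\mapsto H(z,z_x)$, be smooth, and let $\mathcal H=\int H(z,z_x)\,\mathrm dx$. Let $\overline\nabla$ be a discrete gradient. Consider, for $z(x,t)\in\mathbb R^n$, the PDE $$z_t=K\frac{\delta\mathcal H}{\delta z}=K\left(H_z-\partial_xH_{z_x}\right)\qquad(\mathrm{P})$$ and the discrete gradient method with time step $\Delta t\neq0$ $$\frac{z_1-z_0}{\Delta t}=K\left(\overline{H_z}-\partial_x\overline{H_{z_x}}\right).\qquad(\mathrm{D})$$ Then the PDE has an energy conservation law (ECL) with conserved density $H$ and the discrete gradient method has a discrete ECL with the same conserved density $H$, whose flux is the same bilinear form as that of the continuous ECL but with the gradients of the energy density replaced by their discrete gradients. That is, there is a bilinear differential form $B$ such that: (i) every smooth solution $z(x,t)$ of (P) satisfies $$\partial_t\big(H(z,z_x)\big)+\partial_x\big(B(h,h)\big)=0,\qquad h=(H_z,H_{z_x}),$$ with $H_z,H_{z_x}$ evaluated at $(z,z_x)$; (ii) every pair of smooth functions $z_0,z_1$ of $x$ satisfying (D) satisfies $$\frac{H(z_1,z_{1x})-H(z_0,z_{0x})}{\Delta t}+\partial_x\big(B(\overline h,\overline h)\big)=0,\qquad \overline h=(\overline{H_z},\overline{H_{z_x}}).$$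
   Context: Discrete gradient: on a vector space $V$ with inner product $a^\top b$, a discrete gradient assigns to each smooth $H\colon V\to\mathbb R$ a map $\overline\nabla H\colon V\times V\to V$ with $$(v_1-v_0)^\top\overline\nabla H(v_0,v_1)=H(v_1)-H(v_0)\quad\text{for all }v_0,v_1\in V$$ (the discrete gradient axiom). (For consistency one usually also requires $\overline\nabla H(v,v)=\nabla H(v)$, but this is not needed for conservation properties.) We assume $\overline\nabla H$ is smooth enough that all $x$-derivatives written exist. Here $V=\mathbb R^n\times\mathbb R^n$ with variables $(z,z_x)$. $H_z,H_{z_x}\in\mathbb R^n$ denote the partial gradients of $H$ with respect to its first and second arguments, and $\overline{H_z},\overline{H_{z_x}}\in\mathbb R^n$ denote the corresponding components of $\overline\nabla H$. For functions $z_0,z_1$ of $x$ these components are evaluated pointwise in $x$ at $v_0=(z_0(x),z_{0x}(x))$, $v_1=(z_1(x),z_{1x}(x))$, so that at each $x$ $$(z_1-z_0)^\top\overline{H_z}+(z_{1x}-z_{0x})^\top\overline{H_{z_x}}=H(z_1,z_{1x})-H(z_0,z_{0x}).$$ A subscript $x$ or $\partial_x$ denotes the total $x$-derivative. Solutions are smooth functions on an open interval in $x$ (times an open interval in $t$, in the continuous case); no boundary conditions are imposed, and all statements are local in $x$. Bilinear differential form: an expression $B(g,h)=\sum_{j,k\ge0}(\partial_x^jg)^\top C_{jk}\,\partial_x^kh$ (finite sum), for smooth functions $g,h$ of $x$ with values in $\mathbb R^n\times\mathbb R^n$, with constant matrices $C_{jk}$ (in particular, independent of $z$). *)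

(* Defs.v *)
(* MathComp-Analysis *)
From HB Require Import structures.
From mathcomp Require Import all_boot all_order all_algebra.
From mathcomp Require Import all_classical all_reals all_analysis.

Set Implicit Arguments.
Unset Strict Implicit.
Unset Printing Implicit Defensive.

Import Order.TTheory GRing.Theory Num.Theory.
Import numFieldNormedType.Exports.

Local Open Scope ring_scope.
Local Open Scope classical_set_scope.

(* An open interval of R, possibly unbounded (and possibly empty). *)
Definition open_interval (R : realType) (I : set R) : Prop :=
  open I /\ is_interval I.

(* C^k on a set A, meant for A open in a finite-dimensional space U: f is C^0
   if continuous, and C^(k+1) if differentiable with all directional
   derivatives C^k. *)
Fixpoint class_C (R : realType) (U W : normedModType R) (k : nat)
    (A : set U) (f : U -> W) : Prop :=
  match k with
  | 0 => forall u, A u -> {for u, continuous f}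
  | k'.+1 => (forall u, A u -> differentiable f u) /\
             (forall v, class_C k' A (fun u => 'D_v f u))
  end.

Definition smooth_on (R : realType) (U W : normedModType R)
    (A : set U) (f : U -> W) : Prop :=
  forall k, class_C k A f.

(* R^n x R^n is represented by 'cV[R]_(n + n): the pair (a, b) is col_mx a b,
   and its two components are recovered by usubmx and dsubmx. *)

Definition dotp (R : realType) (m : nat) (a b : 'cV[R]_m) : R :=
  (a^T *m b) 0 0.

Definition gradient (R : realType) (m : nat) (H : 'cV[R]_m -> R)
    (v : 'cV[R]_m) : 'cV[R]_m :=
  \col_i 'D_(delta_mx i 0) H v.

(* x |-> (z x, z_x x) *)
Definition jet (R : realType) (n : nat) (z : R -> 'cV[R]_n) (x : R) :
    'cV[R]_(n + n) :=
  col_mx (z x) (derive1 z x).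

(* No consistency condition dg H v v = gradient H v is imposed. *)
Definition discrete_gradient (R : realType) (m : nat)
    (dg : ('cV[R]_m -> R) -> 'cV[R]_m -> 'cV[R]_m -> 'cV[R]_m) : Prop :=
  forall H, smooth_on setT H ->
  forall v0 v1, dotp (v1 - v0) (dg H v0 v1) = H v1 - H v0.

(* For h = (a, b) depending on x: a - d/dx b. At h = (H_z, H_zx) this is the
   variational derivative of the functional with density H(z, z_x). *)
Definition euler (R : realType) (n : nat) (h : R -> 'cV[R]_(n + n)) (x : R) :
    'cV[R]_n :=
  usubmx (h x) - derive1 (fun y => dsubmx (h y)) x.

(* The coefficients C_jk with j, k < bdf_order; all others are zero. *)
Record bilin_diff_form (R : realType) (n : nat) := BilinDiffForm {
  bdf_order : nat ;
  bdf_coef : 'I_bdf_order -> 'I_bdf_order -> 'M[R]_(n + n) }.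

Definition bdf_eval (R : realType) (n : nat) (B : bilin_diff_form R n)
    (g h : R -> 'cV[R]_(n + n)) (x : R) : R :=
  \sum_(j < bdf_order B) \sum_(k < bdf_order B)
    dotp (derive1n j g x) (bdf_coef j k *m derive1n k h x).

(* Main.v *)
Require Import Defs.
From HB Require Import structures.
From mathcomp Require Import all_boot all_order all_algebra.
From mathcomp Require Import all_classical all_reals all_analysis.
From mathcomp Require Import ring lra.

Set Implicit Arguments.
Unset Strict Implicit.
Unset Printing Implicit Defensive.

Import Order.TTheory GRing.Theory Num.Theory.
Import numFieldNormedType.Exports.

Local Open Scope ring_scope.
Local Open Scope classical_set_scope.

(** Write h = (a, b) for the gradient of H (continuous or discrete), e = a - b_x
    for its variational combination and y = K e for the right-hand side of the
    evolution equation.  The rate of change of the density is in both cases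
    y . a + y_x . b:

    - for the PDE, y = z_t, and the chain rule gives
      d/dt H(z, z_x) = z_t . H_z + (z_x)_t . H_{z_x}, where (z_x)_t = (z_t)_x by
      the symmetry of mixed partial derivatives;
    - for the discrete gradient method, y = (z1 - z0) / dt, and the discrete
      gradient axiom divided by dt is this very identity.

    What remains does not see where h and y come from.  Antisymmetry of K gives
    y . e = K e . e = 0, that is y . a = y . b_x, so that
    y . a + y_x . b = d/dx (b . y).  Hence the flux is - b . y = - b . K (a - b_x),
    a bilinear form in h with constant coefficients: this is [flux_form], and
    [is_derive_flux] is the computation just made.

    The form contains b_x, and h is only assumed differentiable once in the
    discrete case; the flux is nevertheless differentiable because along
    solutions K (a - b_x) coincides with y, which is differentiable.

    The symmetry of mixed partials, [derive_comm_class_C], is obtained from the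
    mean value theorem: the second difference of f over a small parallelogram is
    s^2 times either mixed derivative at some nearby point, and both mixed
    derivatives are continuous. *)

(** * Entrywise calculus of column vectors *)

Lemma is_derive_mxP (R : realFieldType) (V : normedModType R) (m n : nat)
    (M : V -> 'M[R]_(m, n)) (t v : V) (dM : 'M[R]_(m, n)) :
  is_derive t v M dM <->
  forall i j, is_derive t v (fun x => M x i j) (dM i j).
Proof.
split=> [[dMt <-] i j|dMij].
  split; first exact: (derivable_mxP _ _ _).1.
  by rewrite derive_mx // mxE.
have dMt : derivable M t v by apply/derivable_mxP => i j; case: (dMij i j).
split=> //; rewrite derive_mx //; apply/matrixP => i j.
by rewrite mxE; case: (dMij i j).
Qed.

Section ColumnCalculus.
Context {R : realType} {V : normedModType R}.
Implicit Types (x v : V).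

Lemma is_derive_col_mx (m n : nat) (f : V -> 'cV[R]_m) (g : V -> 'cV[R]_n)
    x v df dg :
  is_derive x v f df -> is_derive x v g dg ->
  is_derive x v (fun y => col_mx (f y) (g y)) (col_mx df dg).
Proof.
move=> /is_derive_mxP fP /is_derive_mxP gP; apply/is_derive_mxP => i j.
rewrite mxE; under eq_fun do rewrite mxE.
by case: (fintype.split i).
Qed.

Lemma is_derive_dsubmx (m n : nat) (f : V -> 'cV[R]_(m + n)) x v df :
  is_derive x v f df -> is_derive x v (fun y => dsubmx (f y)) (dsubmx df).
Proof.
move=> /is_derive_mxP fP; apply/is_derive_mxP => i j.
by rewrite mxE; under eq_fun do rewrite mxE.
Qed.

Lemma dotpE (m : nat) (a b : 'cV[R]_m) : dotp a b = \sum_i a i 0 * b i 0.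
Proof. by rewrite /dotp mxE; apply: eq_bigr => i _; rewrite mxE. Qed.

Lemma is_derive_dotp (m : nat) (f g : V -> 'cV[R]_m) x v df dg :
  is_derive x v f df -> is_derive x v g dg ->
  is_derive x v (fun y => dotp (f y) (g y)) (dotp df (g x) + dotp (f x) dg).
Proof.
move=> /is_derive_mxP fP /is_derive_mxP gP.
have -> : (fun y => dotp (f y) (g y)) =
    \sum_i ((fun y => f y i 0) * (fun y => g y i 0)).
  by apply/funext => y; rewrite dotpE fct_sumE.
apply: is_derive_eq.
rewrite !dotpE -big_split /=; apply: eq_bigr => i _.
by rewrite addrC /GRing.scale /=; congr (_ + _); rewrite mulrC.
Qed.

End ColumnCalculus.

Section Dotp.
Context {R : realType}.

Lemma dotp0r (m : nat) (a : 'cV[R]_m) : dotp a 0 = 0.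
Proof. by rewrite /dotp mulmx0 mxE. Qed.

Lemma dotpC (m : nat) (a b : 'cV[R]_m) : dotp a b = dotp b a.
Proof. by rewrite !dotpE; apply: eq_bigr => i _; rewrite mulrC. Qed.

Lemma dotpBr (m : nat) (a b c : 'cV[R]_m) : dotp a (b - c) = dotp a b - dotp a c.
Proof. by rewrite /dotp mulmxBr !mxE. Qed.

Lemma dotpZl (m : nat) k (a b : 'cV[R]_m) : dotp (k *: a) b = k * dotp a b.
Proof. by rewrite /dotp linearZ /= -scalemxAl mxE. Qed.

Lemma dotp_col_mx (m n : nat) (a : 'cV[R]_m) (b : 'cV[R]_n) (h : 'cV[R]_(m + n)) :
  dotp (col_mx a b) h = dotp a (usubmx h) + dotp b (dsubmx h).
Proof. by rewrite /dotp -{1}(vsubmxK h) tr_col_mx mul_row_col mxE. Qed.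

Lemma dotp_antisym (m : nat) (K : 'M[R]_m) (e : 'cV[R]_m) :
  K^T = - K -> dotp (K *m e) e = 0.
Proof.
move=> KT; have : dotp (K *m e) e = - dotp (K *m e) e.
  by rewrite {2}dotpC /dotp trmx_mul KT mulmxN mulNmx mxE mulmxA.
lra.
Qed.

(** The chain rule along a curve: the differential of H at w t is linear, hence
    is determined by the directional derivatives that make up the gradient. *)
Lemma is_derive_comp_gradient (m : nat) (H : 'cV[R]_m -> R) (w : R -> 'cV[R]_m)
    (t : R) dw :
  differentiable H (w t) -> is_derive t 1 w dw ->
  is_derive t 1 (fun s => H (w s)) (dotp dw (gradient H (w t))).
Proof.
move=> dH [wt wtE]; have dwt := (derivable1_diffP _ _).1 wt.
have dHw : differentiable (H \o w) t by exact: differentiable_comp.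
split; first exact: diff_derivable.
rewrite deriveE // diff_comp //= -(deriveE _ dwt) wtE {1}(matrix_sum_delta dw).
rewrite linear_sum dotpE; apply: eq_bigr => i _.
by rewrite big_ord1 linearZ /= mxE deriveE.
Qed.

Lemma derivable_gradient (m : nat) (H : 'cV[R]_m -> R) (w : R -> 'cV[R]_m)
    (t : R) :
  smooth_on setT H -> derivable w t 1 ->
  derivable (fun s => gradient H (w s)) t 1.
Proof.
move=> Hs wt; apply/derivable_mxP => i j; under eq_fun do rewrite mxE.
have [_ /(_ (delta_mx i 0))[/(_ (w t) I) dHi _]] := Hs 2%N.
apply: diff_derivable; apply: (differentiable_comp _ dHi).
exact/derivable1_diffP.
Qed.

End Dotp.

(** * Symmetry of mixed directional derivatives *)

Section MixedPartials.
Context {R : realType} {U : normedModType R}.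
Implicit Types (f : U -> R) (a u v : U).

Lemma near_parallelogram (A : set U) a u v : nbhs a A ->
  exists2 s : R, 0 < s & forall c d, 0 <= c <= s -> 0 <= d <= s ->
    A (c *: u + (d *: v + a)).
Proof.
move=> /nbhs_ballP[e /= e0 eA].
have m0 : 0 < `|u| + `|v| + 1 by rewrite ltr_wpDl // addr_ge0.
exists (e / (`|u| + `|v| + 1)); first exact: divr_gt0.
move=> c d /andP[c0 cs] /andP[d0 ds]; apply: eA.
rewrite -ball_normE /= addrA opprD addrCA subrr addr0 normrN.
apply: le_lt_trans (ler_normD _ _) _; rewrite !normrZ !ger0_norm //.
have -> : e = e / (`|u| + `|v| + 1) * (`|u| + `|v| + 1) by rewrite divfK // gt_eqF.
have := ler_wpM2r (normr_ge0 u) cs; have := ler_wpM2r (normr_ge0 v) ds.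
have := divr_gt0 e0 m0; move: (e / _) => s; nra.
Qed.

Lemma is_derive_line f q u (c : R) :
  derivable f (c *: u + q) u ->
  is_derive c 1 (fun s : R => f (s *: u + q)) ('D_u f (c *: u + q)).
Proof.
have E : (fun h => h^-1 *: (((fun s => f (s *: u + q)) \o shift c) (h *: 1) -
             f (c *: u + q))) =
         (fun h => h^-1 *: ((f \o shift (c *: u + q)) (h *: u) - f (c *: u + q))).
  by apply/funext => h /=; rewrite [h *: 1]mulr1 scalerDl addrA.
by move=> d; split; rewrite /derivable /derive E.
Qed.

(** Mean value theorem, applied first along u to the difference of f between the
    two sides of the parallelogram parallel to u, then along v to 'D_u f.  The
    left-hand side is symmetric in u and v, so that exchanging them expresses it
    by the mixed derivative taken in the other order. *)
Lemma second_difference f a u v (s : R) : 0 < s ->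
  (forall c d, 0 <= c <= s -> 0 <= d <= s ->
     derivable f (c *: u + (d *: v + a)) u /\
     derivable ('D_u f) (d *: v + (c *: u + a)) v) ->
  exists c d, [/\ 0 <= c <= s, 0 <= d <= s &
    f (s *: u + (s *: v + a)) - f (s *: u + a) - (f (s *: v + a) - f a) =
    s * s * 'D_v ('D_u f) (d *: v + (c *: u + a))].
Proof.
move=> s0 df; pose g (c : R) := f (c *: u + (s *: v + a)) - f (c *: u + a).
have ss : 0 <= s <= s by rewrite lexx ltW.
have s00 : 0 <= (0 : R) <= s by rewrite lexx ltW.
have dg c : 0 <= c <= s -> is_derive c 1 g
    ('D_u f (c *: u + (s *: v + a)) - 'D_u f (c *: u + a)).
  move=> cs; have [d1 _] := df c s cs ss; have [+ _] := df c 0 cs s00.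
  rewrite scale0r add0r => d2.
  by apply: is_deriveB; apply: is_derive_line.
have [c cs gE] : exists2 c, c \in `]0, s[%R & g s - g 0 =
    ('D_u f (c *: u + (s *: v + a)) - 'D_u f (c *: u + a)) * (s - 0).
  apply: MVT => // [c|].
    by rewrite in_itv /= => /andP[/ltW c0 /ltW cs]; apply: dg; rewrite c0.
  apply: derivable_within_continuous => c; rewrite in_itv /= => cs.
  by case: (dg c cs).
have {}cs : 0 <= c <= s by move: cs; rewrite in_itv /= => /andP[/ltW -> /ltW ->].
pose k (d : R) := 'D_u f (d *: v + (c *: u + a)).
have dk d : 0 <= d <= s ->
    is_derive d 1 k ('D_v ('D_u f) (d *: v + (c *: u + a))).
  by move=> ds; apply: is_derive_line; case: (df c d cs ds).
have [d ds kE] : exists2 d, d \in `]0, s[%R & k s - k 0 =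
    'D_v ('D_u f) (d *: v + (c *: u + a)) * (s - 0).
  apply: (MVT (df := fun d => 'D_v ('D_u f) (d *: v + (c *: u + a))) s0) => [d|].
    by rewrite in_itv /= => /andP[/ltW d0 /ltW ds]; apply: dk; rewrite d0.
  apply: derivable_within_continuous => d; rewrite in_itv /= => ds.
  by case: (dk d ds).
exists c, d; split=> //.
  by move: ds; rewrite in_itv /= => /andP[/ltW -> /ltW ->].
move: gE kE; rewrite /g /k !scale0r !add0r (addrCA (s *: v)) => -> ->.
by rewrite subr0 -mulrA mulrC.
Qed.

(** Both mixed derivatives equal, at points close to a, the same second difference
    divided by s^2; continuity at a brings them within any e of each other. *)
Lemma derive_comm f a u v :
  (\forall y \near a, derivable f y u) -> (\forall y \near a, derivable f y v) ->
  (\forall y \near a, derivable ('D_u f) y v) ->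
  (\forall y \near a, derivable ('D_v f) y u) ->
  {for a, continuous ('D_v ('D_u f))} -> {for a, continuous ('D_u ('D_v f))} ->
  'D_u ('D_v f) a = 'D_v ('D_u f) a.
Proof.
move=> fu fv fuv fvu cuv cvu; apply/eqP; rewrite eq_sym -subr_eq0 -normr_le0.
apply/ler_addgt0Pr => e e0; rewrite add0r.
have e20 : 0 < e / 2 by rewrite divr_gt0.
move/cvgrPdist_le : cuv => /(_ _ e20) cuv.
move/cvgrPdist_le : cvu => /(_ _ e20) cvu.
have [s s0 sA] := near_parallelogram u v
  (filterI (filterI (filterI fu fv) (filterI fuv fvu)) (filterI cuv cvu)).
have [c [d [cs ds]]] : exists c d, [/\ 0 <= c <= s, 0 <= d <= s &
    f (s *: u + (s *: v + a)) - f (s *: u + a) - (f (s *: v + a) - f a) =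
    s * s * 'D_v ('D_u f) (d *: v + (c *: u + a))].
  apply: second_difference => // c d cs ds; rewrite (addrCA (d *: v)).
  by have [[[fuP _] [fuvP _]] _] := sA c d cs ds; split; [exact: fuP|exact: fuvP].
have [d' [c' [ds' cs']]] : exists d c, [/\ 0 <= d <= s, 0 <= c <= s &
    f (s *: v + (s *: u + a)) - f (s *: v + a) - (f (s *: u + a) - f a) =
    s * s * 'D_u ('D_v f) (c *: u + (d *: v + a))].
  apply: second_difference => // d1 c1 d1s c1s; rewrite (addrCA (d1 *: v)).
  have [[[_ fvP] [_ fvuP]] _] := sA c1 d1 c1s d1s.
  by split; [exact: fvP|exact: fvuP].
rewrite (addrCA (d *: v)) (addrCA (s *: v)).
have [_ [/= + _]] := sA c d cs ds; have [_ [_ /=]] := sA c' d' cs' ds'.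
move: ('D_u ('D_v f) (c' *: u + _)) ('D_v ('D_u f) (c *: u + _)) => m m'.
move: ('D_u ('D_v f) a) ('D_v ('D_u f) a) => l l'.
move: (f _) (f _) (f _) (f _) => f1 f2 f3 f4 lm lm' E2 E1.
have mm' : m = m'.
  have ss0 : s * s != 0 by rewrite mulf_neq0 // gt_eqF.
  by apply: (mulfI ss0); rewrite -E1 -E2; ring.
rewrite -mm' in lm'.
rewrite -(subrKA m) (le_trans (ler_normD _ _)) // (splitr e) lerD //.
by rewrite distrC.
Qed.

End MixedPartials.

(** The mean value theorem is a statement about real-valued functions, so that
    the vector-valued case goes through the entries of f. *)
Lemma derive_comm_class_C (R : realType) (U : normedModType R) (m n : nat)
    (A : set U) (f : U -> 'M[R]_(m, n)) (a u v : U) :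
  open A -> class_C 2 A f -> A a -> 'D_u ('D_v f) a = 'D_v ('D_u f) a.
Proof.
move=> Ao [f1 f2] Aa.
have nearA (y : U) (P : U -> Prop) : A y -> (forall z, A z -> P z) -> \near y, P y.
  by move=> Ay AP; apply: filterS AP _; exact: open_nbhs_nbhs.
apply/matrixP => i j; pose g (y : U) := f y i j.
have dg w y : A y -> is_derive y w g ('D_w f y i j).
  move=> Ay; apply: (is_derive_mxP f y w _).1.
  exact/derivableP/diff_derivable/f1.
have ddg w w' y : A y -> is_derive y w' ('D_w g) ('D_w' ('D_w f) y i j).
  move=> Ay; apply: (@near_eq_is_derive _ _ _ (fun z => 'D_w f z i j)).
    by apply: nearA Ay _ => z Az; case: (dg w z Az).
  apply: (is_derive_mxP ('D_w f) y w' _).1.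
  by apply/derivableP/diff_derivable; have [+ _] := f2 w; exact.
have cg w w' : {for a, continuous ('D_w' ('D_w g))}.
  have [_ /(_ w' a Aa) cf] := f2 w.
  rewrite /prop_for /continuous_at /=; have [_ ->] := ddg w w' a Aa.
  apply: (@cvg_trans _ ((fun y => 'D_w' ('D_w f) y i j) @ a)).
    apply: near_eq_cvg; apply: nearA Aa _ => y Ay.
    by case: (ddg w w' y Ay) => _ ->.
  exact: (cvg_comp _ _ cf (@coord_continuous _ _ _ i j _)).
have [_ vuE] := ddg v u a Aa.
have [_ uvE] := ddg u v a Aa.
transitivity ('D_u ('D_v g) a); first exact: esym vuE.
transitivity ('D_v ('D_u g) a); last exact: uvE.
apply: derive_comm; last 2 first.
- exact: cg.
- exact: cg.
- apply: nearA Aa _ => y Ay.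
  by have [gu _] := dg u y Ay.
- apply: nearA Aa _ => y Ay.
  by have [gv _] := dg v y Ay.
- apply: nearA Aa _ => y Ay.
  by have [guv _] := ddg u v y Ay.
- apply: nearA Aa _ => y Ay.
  by have [gvu _] := ddg v u y Ay.
Qed.

(** * Partial derivatives of functions of (x, t) *)

Section Slices.
Context {R : realType} {W : normedModType R}.
Implicit Types (f : R * R -> W) (x t : R).

Lemma derive1_slice1 f x t :
  (fun y => f (y, t))^`() x = 'D_(1, 0) f (x, t).
Proof.
rewrite derive1E /derive.
rewrite (_ : (fun h => h^-1 *: (((fun y => f (y, t)) \o shift x) (h *: 1) - _)) =
  (fun h => h^-1 *: ((f \o shift (x, t)) (h *: (1, 0)) - f (x, t)))) //.
apply/funext => h /=; congr (_ *: (f _ - _)).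
by congr (_, _); rewrite /= [h *: 0]mulr0 add0r.
Qed.

Lemma derive1_slice2 f x t :
  (fun s => f (x, s))^`() t = 'D_(0, 1) f (x, t).
Proof.
rewrite derive1E /derive.
rewrite (_ : (fun h => h^-1 *: (((fun s => f (x, s)) \o shift t) (h *: 1) - _)) =
  (fun h => h^-1 *: ((f \o shift (x, t)) (h *: (0, 1)) - f (x, t)))) //.
apply/funext => h /=; congr (_ *: (f _ - _)).
by congr (_, _); rewrite /= [h *: 0]mulr0 add0r.
Qed.

Lemma is_derive_slice1 f x t : differentiable f (x, t) ->
  is_derive x 1 (fun y => f (y, t)) ('D_(1, 0) f (x, t)).
Proof.
move=> df; split; last by rewrite -derive1E derive1_slice1.
apply/derivable1_diffP.
have dp : differentiable (fun y : R => (y, t)) x by exact: differentiable_pair.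
exact: (differentiable_comp dp df).
Qed.

Lemma is_derive_slice2 f x t : differentiable f (x, t) ->
  is_derive t 1 (fun s => f (x, s)) ('D_(0, 1) f (x, t)).
Proof.
move=> df; split; last by rewrite -derive1E derive1_slice2.
apply/derivable1_diffP.
have dp : differentiable (fun s : R => (x, s)) t by exact: differentiable_pair.
exact: (differentiable_comp dp df).
Qed.

End Slices.

(** * The energy flux *)

(** The form (g, h) |-> - g_b . K (h_a - d/dx h_b), with g = (g_a, g_b) and
    h = (h_a, h_b).  The order is 2 because of the derivative of h_b; no
    derivative of g occurs. *)
Definition flux_form (R : realType) (n : nat) (K : 'M[R]_n) :
    bilin_diff_form R n :=
  @BilinDiffForm R n 2 (fun j k =>
    if j == 0 then if k == 0 then block_mx 0 0 (- K) 0 else block_mx 0 0 0 K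
    else 0).

Section Flux.
Context {R : realType} {n : nat} (K : 'M[R]_n).
Implicit Types (h : R -> 'cV[R]_(n + n)) (y : R -> 'cV[R]_n) (x : R).

Lemma flux_formE h x : derivable h x 1 ->
  bdf_eval (flux_form K) h h x = - dotp (dsubmx (h x)) (K *m euler h x).
Proof.
move=> hx; rewrite /bdf_eval /= !big_ord_recl !big_ord0 /= !mul0mx !dotp0r !addr0.
have -> : euler h x = usubmx (h x) - dsubmx (derive1 h x).
  congr (_ - _); rewrite !derive1E.
  by case: (is_derive_dsubmx (derivableP hx)).
rewrite -{2}(vsubmxK (h x)) -{1}(vsubmxK (derive1 h x)) !mul_block_col.
rewrite !mul0mx !addr0 !add0r.
rewrite dotpC dotp_col_mx (dotpC (h x)) dotp_col_mx.
rewrite !(dotpC 0) !dotp0r !add0r mulmxBr dotpBr mulNmx.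
rewrite !(dotpC _ (dsubmx _)) -[- (K *m _)]add0r dotpBr dotp0r; ring.
Qed.

(** The conservation law common to the continuous and the discrete equation: when
    y = K (a - b_x), the flux - b . y has derivative - (b_x . y + b . y_x), and
    b_x . y = a . y because K is antisymmetric.  The equation for y is required on
    a neighbourhood of x because the flux, which involves b_x, is known to be
    differentiable only through its expression in terms of y. *)
Lemma is_derive_flux (I : set R) h y x dy :
  K^T = - K -> open I -> I x ->
  (forall x', I x' -> derivable h x' 1) ->
  (forall x', I x' -> y x' = K *m euler h x') ->
  is_derive x 1 y dy ->
  is_derive x 1 (bdf_eval (flux_form K) h h) (- dotp (col_mx (y x) dy) (h x)).
Proof.
move=> KT Io Ix hI yE dyx.
have hx := derivableP (hI x Ix).
apply: (@near_eq_is_derive _ _ _ (fun x' => - dotp (dsubmx (h x')) (y x'))).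
  near=> x'.
  have Ix' : I x' by near: x'; exact: open_nbhs_nbhs.
  by rewrite flux_formE ?yE //; exact: hI.
have dF := is_derive_dotp (is_derive_dsubmx hx) dyx.
apply: is_derive_eq; congr (- _).
have := dotp_antisym (euler h x) KT; rewrite -yE // /euler dotpBr.
rewrite derive1E; have [_ ->] := is_derive_dsubmx hx => /eqP.
rewrite subr_eq0 => /eqP eab.
by rewrite dotp_col_mx eab (dotpC _ dy) (dotpC (y x)).
Unshelve. all: by end_near. Qed.

End Flux.

(** * The two conservation laws *)

Theorem proposition1 (R : realType) (n : nat) (K : 'M[R]_n)
    (K_antisym : K^T = - K)
    (H : 'cV[R]_(n + n) -> R) (H_smooth : smooth_on setT H)
    (dg : ('cV[R]_(n + n) -> R) ->
          'cV[R]_(n + n) -> 'cV[R]_(n + n) -> 'cV[R]_(n + n))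
    (dg_axiom : discrete_gradient dg)
    (dt : R) (dt_neq0 : dt != 0) :
  exists B : bilin_diff_form R n,
    (forall (I J : set R) (z : R -> R -> 'cV[R]_n),
      open_interval I -> open_interval J ->
      smooth_on (I `*` J) (fun p : R * R => z p.1 p.2) ->
      let w (x t : R) := jet (fun y => z y t) x in
      let h (t x : R) := gradient H (w x t) in
      (forall x t, I x -> J t -> derive1 (z x) t = K *m euler (h t) x) ->
      forall x t, I x -> J t ->
        [/\ derivable (fun s => H (w x s)) t 1,
            derivable (bdf_eval B (h t) (h t)) x 1 &
            derive1 (fun s => H (w x s)) t + derive1 (bdf_eval B (h t) (h t)) x = 0])
    /\
    (forall (I : set R) (z0 z1 : R -> 'cV[R]_n),
      open_interval I -> smooth_on I z0 -> smooth_on I z1 ->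
      let hbar (x : R) := dg H (jet z0 x) (jet z1 x) in
      (forall x, I x -> derivable hbar x 1) ->
      (forall x, I x -> dt^-1 *: (z1 x - z0 x) = K *m euler hbar x) ->
      forall x, I x ->
        derivable (bdf_eval B hbar hbar) x 1 /\
        (H (jet z1 x) - H (jet z0 x)) / dt + derive1 (bdf_eval B hbar hbar) x = 0).
Proof.
exists (flux_form K); split.
- move=> I J z [Io _] [Jo _] zs w h Pz x t Ix Jt.
  pose f (p : R * R) := z p.1 p.2.
  have IJo : open (I `*` J).
    rewrite openE => -[x' t'] [/= Ix' Jt']; exists (I, J) => //.
    by split; exact: open_nbhs_nbhs.
  have [f1 f2] := zs 2%N.
  have df0 x' t' : I x' -> J t' -> differentiable f (x', t').
    by move=> Ix' Jt'; exact: f1.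
  have df x' t' v : I x' -> J t' -> differentiable ('D_v f) (x', t').
    by move=> Ix' Jt'; have [+ _] := f2 v; exact.
  have H1 v : differentiable H v by have [+ _] := H_smooth 1%N; exact.
  have wE x' t' : w x' t' = col_mx (f (x', t')) ('D_(1, 0) f (x', t')).
    by rewrite /w /jet -derive1_slice1.
  have hx x' : I x' -> derivable (h t) x' 1.
    move=> Ix'; apply: derivable_gradient => //.
    under eq_fun do rewrite wE.
    have [+ _] := is_derive_col_mx (is_derive_slice1 (df0 x' t Ix' Jt))
      (is_derive_slice1 (df x' t (1, 0) Ix' Jt)).
    exact.
  have dw : is_derive t 1 (w x)
      (col_mx ('D_(0, 1) f (x, t)) ('D_(0, 1) ('D_(1, 0) f) (x, t))).
    rewrite (_ : w x = fun s => col_mx (f (x, s)) ('D_(1, 0) f (x, s))); last first.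
      by apply/funext => s; rewrite wE.
    exact: is_derive_col_mx (is_derive_slice2 (df0 x t Ix Jt))
      (is_derive_slice2 (df x t (1, 0) Ix Jt)).
  have [dH dHE] := is_derive_comp_gradient (H1 (w x t)) dw.
  (* As a function of (x, t), the right-hand side of the PDE is 'D_(0, 1) f. *)
  have [dF dFE] := is_derive_flux K_antisym Io Ix hx
    (y := fun x' => 'D_(0, 1) f (x', t))
    (fun x' Ix' => etrans (esym (derive1_slice2 f x' t)) (Pz x' t Ix' Jt))
    (is_derive_slice1 (df x t (0, 1) Ix Jt)).
  split => //; rewrite !derive1E dHE dFE (derive_comm_class_C _ _ IJo (zs 2%N)) //.
  by rewrite subrr.
- move=> I z0 z1 [Io _] z0s z1s hbar hbarx Dz x Ix.
  have dz z : smooth_on I z -> is_derive x 1 z (derive1 z x).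
    move=> /(_ 1%N)[+ _] => /(_ x Ix)/diff_derivable zx.
    by rewrite derive1E; exact: derivableP.
  have dy : is_derive x 1 (dt^-1 *: (z1 - z0)) (dt^-1 *: (derive1 z1 x - derive1 z0 x)).
    by apply: is_deriveZ; apply: is_deriveB; exact: dz.
  have [dF dFE] := is_derive_flux K_antisym Io Ix hbarx Dz dy.
  split => //; rewrite derive1E dFE.
  have -> : col_mx ((dt^-1 *: (z1 - z0)) x) (dt^-1 *: (derive1 z1 x - derive1 z0 x)) =
            dt^-1 *: (jet z1 x - jet z0 x).
    by rewrite /jet opp_col_mx add_col_mx scale_col_mx.
  by rewrite dotpZl dg_axiom // mulrC subrr.
Qed.
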